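(* Suppose $X$ has a minimum $a$ and a maximum $b$, i.e., $X=[a,b]$. Let $\varphi\in\mathcal{OP}(X)\setminus\mathcal{O}(X)$ with ideal $X_1$, and let $X_2=X\setminus X_1$. Then $\langle \mathcal{O}(X),\varphi\rangle=\mathcal{OP}(X)$ if and only if, for each $i\in\{1,2\}$, there is a set $Y_i\subseteq X_i$ which is order-isomorphic to an open convex subset of $X$ such that $\varphi|_{Y_i}$ is an order-isomorphism (from $Y_i$ onto $Y_i\varphi$).
   Context: Maps are written on the right of their arguments and composed from left to right. Throughout, $X$ is an infinite linearly ordered set that is dense (for all $x<y$ in $X$ there is $z\in X$ with $x<z<y$). A subset $C\subseteq X$ is convex if $x,y\in C$, $z\in X$ and $x<z<y$ imply $z\in C$; an open convex subset of $X$ is a nonempty convex subset of $X$ having neither a minimum nor a maximum. For sets, $A<B$ means $a<b$ for all $a\in A$, $b\in B$. It is assumed that $X$ satisfies: (a) if $X=X'\cup X''$ with $X'<X''$ and $X',X''\neq\emptyset$, then $X'$ has a maximum or $X''$ has a minimum; (b) any two open convex subsets of $X$ are order-isomorphic. $\mathcal{T}(X)$ is the monoid of all maps $X\to X$ under composition, and $\mathcal{O}(X)$ is its submonoid of order-preserving maps ($x\le y$ implies $x\alpha\le y\alpha$). An order-isomorphism is an order-preserving bijection between subchains; subchains are order-isomorphic if there is an order-isomorphism between them. A map $\alpha\in\mathcal{T}(X)$ is orientation-preserving if there is a nonempty subset $X_1\subseteq X$ such that, with $X_2=X\setminus X_1$: (1) $\alpha$ is order-preserving on $X_1$ and on $X_2$;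 and (2) for all $p\in X_1$ and $q\in X_2$, $p<q$ and $p\alpha\ge q\alpha$. Such a set $X_1$ is called an ideal of $\alpha$; it is unique if $\alpha$ is non-constant. $\mathcal{OP}(X)$ is the monoid of all orientation-preserving maps on $X$, and $\mathcal{O}(X)\subseteq\mathcal{OP}(X)$. $\langle\mathcal{O}(X),\varphi\rangle$ denotes the subsemigroup generated by $\mathcal{O}(X)\cup\{\varphi\}$. *)

(* Defs.v *)
From mathcomp Require Import all_boot all_order.
From mathcomp Require Import boolp classical_sets functions cardinality.

Set Implicit Arguments.
Unset Strict Implicit.
Unset Printing Implicit Defensive.

Import Order.TTheory.

Local Open Scope order_scope.
Local Open Scope classical_set_scope.

Section Defs.
Context {d : Order.disp_t} {X : orderType d}.
Implicit Types (A B C : set X) (f g : X -> X).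

Definition dense_order : Prop :=
  forall x y : X, x < y -> exists z : X, x < z /\ z < y.

Definition is_max A (m : X) : Prop := A m /\ ubound A m.

Definition is_min A (m : X) : Prop := A m /\ lbound A m.

Definition convex C : Prop :=
  forall x y z : X, C x -> C y -> x < z -> z < y -> C z.

Definition open_convex C : Prop :=
  [/\ C !=set0, convex C,
      ~ (exists m, is_min C m) & ~ (exists m, is_max C m)].

Definition cut_complete : Prop :=
  forall A B : set X, A `|` B = setT ->
    (forall x y, A x -> B y -> x < y) -> A !=set0 -> B !=set0 ->
    (exists m, is_max A m) \/ (exists m, is_min B m).

Definition order_preserving_on A f : Prop :=
  forall x y : X, A x -> A y -> x <= y -> f x <= f y.

(* The restriction of [f] to [A] is an order-isomorphism from [A] onto [B];
   the values of [f] outside [A] are irrelevant. *)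
Definition order_iso_on A B f : Prop :=
  set_bij A B f /\ order_preserving_on A f.

(* Quantifying over total maps loses no generality: a map defined on a subset
   of [X] with values in [X] extends arbitrarily. *)
Definition order_isomorphic A B : Prop := exists f, order_iso_on A B f.

Definition open_convex_isomorphic : Prop :=
  forall C C' : set X, open_convex C -> open_convex C' ->
    order_isomorphic C C'.

Definition is_ideal f (X1 : set X) : Prop :=
  [/\ X1 !=set0,
      order_preserving_on X1 f,
      order_preserving_on (~` X1) f &
      forall p q : X, X1 p -> (~` X1) q -> p < q /\ f q <= f p].

Definition orientation_preserving f : Prop := exists X1, is_ideal f X1.

(* Maps act on the right, so the product of [f] and [g] is [f \; g], which
   sends [x] to [g (f x)]. *)
Definition comp_closed (M : set (X -> X)) : Prop :=
  forall f g, M f -> M g -> M (f \; g)%FUN.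

Definition generated_semigroup (G : set (X -> X)) : set (X -> X) :=
  smallest comp_closed G.

End Defs.

Arguments dense_order {d} X.
Arguments cut_complete {d} X.
Arguments open_convex_isomorphic {d} X.

Definition Ord {d : Order.disp_t} (X : orderType d) : set (X -> X) :=
  [set f | order_preserving_on setT f].

Definition OP {d : Order.disp_t} (X : orderType d) : set (X -> X) :=
  [set f | orientation_preserving f].

Arguments Ord {d} X _.
Arguments OP {d} X _.

(* Main.v *)
Require Import Defs.
From mathcomp Require Import all_boot all_order.
From mathcomp Require Import boolp classical_sets functions cardinality.

Import Order.TTheory.
Local Open Scope order_scope.
Local Open Scope classical_set_scope.

(** Write [phi_i] for the restriction of [phi] to [X_i].

    If [phi_1] and [phi_2] are injective on copies [Y_1], [Y_2] of an open
    convex set, then every [psi] in [OP X] with ideal [Z_1] factors as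
    [alpha \; phi \; beta] with [alpha] and [beta] order-preserving.  By
    homogeneity and density the whole of [X] embeds in each [Y_i]
    ([embedding_in_open_convex], [embedding_in_copy]); [alpha] sends [Z_1] into
    [Y_1] and its complement into [Y_2].  Leaving a point of [Y_1] below the
    image of [Z_1] unused makes [alpha \; phi] injective; as [Z_1] is also an
    ideal of [alpha \; phi], [psi] is a monotone function of [alpha \; phi], and
    by completeness that function extends to some [beta] in [Ord X]
    ([monotone_factor]).
    This gives [OP_factor].  Since [OP X] is closed under composition
    ([OP_comp_closed]), the generated semigroup is then exactly [OP X].

    Conversely, suppose for instance that [phi_1] is injective on no copy of an
    open convex set.  Then every injective member of the generated semigroup is
    order-preserving on [X] minus its minimum ([generated_injective_monotone]):
    if a prefix [f] of a product is injective and order-preserving there but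
    takes a value in the initial segment [X_1], then it takes values in [X_1] on
    a whole open interval, whose image is a copy on which [phi] is injective.
    For [phi_2] the maximum plays the role of the minimum.  But some injective
    members of [OP X] reverse the order of two points distinct from both
    endpoints ([injective_rotation]), so that they are order-preserving neither
    off the minimum nor off the maximum. *)

Section Maps.
Context {d : Order.disp_t} {X : orderType d}.
Implicit Types (A B C Y U W : set X) (f g h psi : X -> X).

(** * Ideals and orientation-preserving maps *)

Lemma Ord_sub_OP (a : X) : Ord X `<=` OP X.
Proof.
move=> f fO; exists setT; split => //; first by exists a.
by move=> p q _ /(_ I).
Qed.

Lemma ideal_down f A x y : is_ideal f A -> A y -> x <= y -> A x.
Proof.
move=> [_ _ _ fA] Ay xy; apply: contrapT => nAx.
by have [/lt_le_trans/(_ xy)] := fA _ _ Ay nAx; rewrite ltxx.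
Qed.

Lemma ideal_up f A x y : is_ideal f A -> (~` A) x -> x <= y -> (~` A) y.
Proof. by move=> fA nAx xy Ay; apply/nAx/(ideal_down _ _ _ _ fA Ay). Qed.

(** If [f] and [g] have ideals [A] and [B], the set [A] splits into
    [A `&` f @^-1` B] and the rest, and likewise for its complement; one of the
    first and the last of these four consecutive blocks is empty.  This
    determines the ideal of [f \; g]. *)
Lemma OP_comp_closed : comp_closed (OP X).
Proof.
move=> f g [A fA] [B gB].
have [A0 fA1 fA2 fA3] := fA; have [_ gB1 gB2 gB3] := gB.
have [[x0 [Ax0 Bx0]]|p0] := pselect (exists x, A x /\ B (f x)).
- have q2 y : ~ A y -> B (f y).
    by move=> nAy; have [_] := fA3 _ _ Ax0 nAy; apply: ideal_down gB Bx0.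
  exists [set x | A x /\ B (f x)]; split.
  + by exists x0.
  + by move=> x y [Ax Bx] [Ay By] xy; apply: gB1 => //; apply: fA1.
  + move=> x y nx ny xy.
    have [Ax|nAx] := pselect (A x); have [Ay|nAy] := pselect (A y).
    * apply: gB2; [by move=> ?; apply: nx|by move=> ?; apply: ny|exact: fA1].
    * have nBx : ~ B (f x) by move=> ?; apply: nx.
      by have [] := gB3 _ _ (q2 _ nAy) nBx.
    * by case: nAx; apply: ideal_down fA Ay xy.
    * by apply: gB1; [exact: q2|exact: q2|exact: fA2].
  + move=> p q [Ap Bp] nq; have [Aq|nAq] := pselect (A q).
      have nBq : ~ B (f q) by move=> ?; apply: nq.
      split; last by have [] := gB3 _ _ Bp nBq.
      rewrite ltNge; apply/negP => qp; apply: nBq.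
      exact: (ideal_down _ _ _ _ gB Bp (fA1 _ _ Aq Ap qp)).
    have [pq fqp] := fA3 _ _ Ap nAq; split=> //.
    exact: (gB1 _ _ (q2 _ nAq) Bp fqp).
- have p1 x : A x -> ~ B (f x) by move=> ? ?; apply: p0; exists x.
  exists [set x | A x \/ B (f x)]; split.
  + by case: A0 => x Ax; exists x; left.
  + move=> x y.
    have [Ax|nAx] := pselect (A x); have [Ay|nAy] := pselect (A y) => Hx Hy xy.
    * by apply: gB2; [exact: p1|exact: p1|exact: fA1].
    * case: Hy => // By; have [] := gB3 _ _ By (p1 _ Ax); by [].
    * by case: nAx; apply: ideal_down fA Ay xy.
    * by case: Hx => // Bx; case: Hy => // By; apply: gB1 => //; apply: fA2.
  + move=> x y /not_orP[nAx nBx] /not_orP[nAy nBy] xy.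
    by apply: gB2 => //; apply: fA2.
  + move=> p q Hp /not_orP[nAq nBq].
    have [Ap|nAp] := pselect (A p).
      have [pq fqp] := fA3 _ _ Ap nAq; split=> //.
      by apply: gB2 => //; apply: p1.
    case: Hp => // Bp; split; last by have [] := gB3 _ _ Bp nBq.
    rewrite ltNge; apply/negP => qp; apply: nBq.
    exact: (ideal_down _ _ _ _ gB Bp (fA2 _ _ nAq nAp qp)).
Qed.

(** * Order-isomorphisms and intervals *)

Lemma order_iso_lt A B f x y : order_iso_on A B f ->
  A x -> A y -> x < y -> f x < f y.
Proof.
move=> [[_ fI _] fm] Ax Ay xy; rewrite lt_neqAle fm ?(ltW xy)// andbT.
apply/eqP => /fI; rewrite !inE => /(_ Ax Ay) exy.
by rewrite exy ltxx in xy.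
Qed.

Lemma order_isomorphic_sym A B : order_isomorphic A B -> order_isomorphic B A.
Proof.
move=> [f fAB]; have [[fF fI fS] fm] := fAB.
pose g y := xget y [set x | A x /\ f x = y].
have gP y : B y -> A (g y) /\ f (g y) = y.
  by case/fS => x Ax fx; apply: (@xgetI _ y [set x | A x /\ f x = y] x).
have gf x : A x -> g (f x) = x.
  move=> Ax; have [Ag fg] := gP _ (fF _ Ax).
  by apply: fI fg; rewrite inE.
exists g; split; first split.
- by move=> y /gP[].
- move=> x y; rewrite !inE => /gP[_ {2}<-] /gP[_ {2}<-] ->; by [].
- by move=> x Ax; exists (f x); [exact: fF|exact: gf].
- move=> x y /gP[Agx fgx] /gP[Agy fgy] xy; rewrite leNgt; apply/negP => lt.
  have := order_iso_lt _ _ _ _ _ fAB Agy Agx lt.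
  by rewrite fgx fgy ltNge xy.
Qed.

Lemma order_iso_image A f : {in A &, injective f} -> order_preserving_on A f ->
  order_iso_on A (f @` A) f.
Proof. by move=> fI fm; split => //; split => // x Ax; exists x. Qed.

Context (X_dense : dense_order X).

Lemma open_convex_itv (x y : X) : x < y -> open_convex [set z | x < z < y].
Proof.
move=> xy; split.
- by have [z [xz zy]] := X_dense _ _ xy; exists z; rewrite /= xz.
- move=> u v z /= /andP[xu _] /andP[_ vy] uz zv.
  by rewrite (lt_trans xu uz) (lt_trans zv vy).
- move=> [m [/= /andP[xm my]]] lb; have [z [xz zm]] := X_dense _ _ xm.
  by have := lb z; rewrite /= xz (lt_trans zm my) leNgt zm => /(_ isT).
- move=> [m [/= /andP[xm my]]] ub; have [z [mz zy]] := X_dense _ _ my.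
  by have := ub z; rewrite /= zy (lt_trans xm mz) leNgt mz => /(_ isT).
Qed.

(** * Injective elements of the generated semigroup *)

(** [Y] is a copy of an open convex set, inside [W], on which [phi] is an
    order-isomorphism. *)
Definition iso_copy phi W Y : Prop :=
  [/\ Y `<=` W, exists C, open_convex C /\ order_isomorphic Y C &
      order_iso_on Y (phi @` Y) phi].

(** In the applications [W] is the ideal of [phi] or its complement, and [U] is
    [X] minus the endpoint that lies in [W]; the third hypothesis is then
    [ideal_preimage_open] or [coideal_preimage_open]. *)
Lemma generated_injective_monotone phi U W :
  order_preserving_on W phi -> order_preserving_on (~` W) phi ->
  (forall f, order_preserving_on U f -> U `&` f @^-1` W !=set0 ->
     exists2 C, open_convex C & C `<=` U `&` f @^-1` W) ->
  ~ (exists Y, iso_copy phi W Y) ->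
  forall g, generated_semigroup (Ord X `|` [set phi]) g -> injective g ->
  order_preserving_on U g.
Proof.
move=> phiW phiCW UW noY g gen ginj.
(* The elements [g] whose right multiplication preserves the property to be
   proved form a set closed under composition; the identity is the [f] that
   gives the claim back. *)
pose S := [set g : X -> X | forall f, order_preserving_on U f ->
  injective (f \; g)%FUN -> order_preserving_on U (f \; g)%FUN].
suff : S g by move=> /(_ id); apply=> // x y.
apply: gen; split.
- move=> g1 g2 S1 S2 f fU inj; apply: (S2 (f \; g1)%FUN) => //; apply: S1 => //.
  by move=> x y /= e; apply: inj => /=; rewrite e.
- move=> {ginj} {}g [gO f fU _ x y Ux Uy xy|-> f fU inj]; first exact: gO (fU _ _ _ _ _).
  have [/(UW _ fU)[C Copen CUW]|/forallNP nUW] :=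
    pselect (U `&` f @^-1` W !=set0).
    case: noY; exists (f @` C); split.
    + by move=> _ [x /CUW[_ Wx] <-].
    + exists C; split=> //; apply: order_isomorphic_sym; exists f.
      apply: order_iso_image; last first.
        by move=> x y /CUW[Ux _] /CUW[Uy _]; apply: fU.
      by move=> x y _ _ e; apply: inj => /=; rewrite e.
    + apply: order_iso_image.
        move=> x y; rewrite !inE => -[u Cu <-] [v Cv <-] e.
        by rewrite (inj u v e).
      by move=> _ _ [u /CUW[_ Wu] <-] [v /CUW[_ Wv] <-]; apply: phiW.
  move=> x y Ux Uy xy /=; apply: phiCW; last exact: fU.
  + by move=> Wx; apply: (nUW x).
  + by move=> Wy; apply: (nUW y).
Qed.

Context (a b : X) (a_min : is_min [set: X] a) (b_max : is_max [set: X] b).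

Let ax x : a <= x. Proof. by case: a_min => _; apply. Qed.
Let xb x : x <= b. Proof. by case: b_max => _; apply. Qed.

Lemma ideal_preimage_open f phi A : is_ideal phi A ->
  order_preserving_on [set x | a < x] f ->
  [set x | a < x] `&` f @^-1` A !=set0 ->
  exists2 C, open_convex C & C `<=` [set x | a < x] `&` f @^-1` A.
Proof.
move=> idA fm [x [/= lt_ax Ax]]; exists [set z | a < z < x].
  exact: open_convex_itv.
move=> z /= /andP[az zx]; split=> //.
exact: (ideal_down _ _ _ _ idA Ax (fm _ _ az lt_ax (ltW zx))).
Qed.

Lemma coideal_preimage_open f phi A : is_ideal phi A ->
  order_preserving_on [set x | x < b] f ->
  [set x | x < b] `&` f @^-1` (~` A) !=set0 ->
  exists2 C, open_convex C & C `<=` [set x | x < b] `&` f @^-1` (~` A).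
Proof.
move=> idA fm [x [/= lt_xb Ax]]; exists [set z | x < z < b].
  exact: open_convex_itv.
move=> z /= /andP[xz zb]; split=> //.
exact: (ideal_up _ _ _ _ idA Ax (fm _ _ lt_xb zb (ltW xz))).
Qed.

(** * Embedding the whole chain in open convex sets *)

Context (X_homog : open_convex_isomorphic X) (lt_ab : a < b).

(** The embedding leaves a point of [C] below its image unused. *)
Lemma embedding_in_open_convex C : open_convex C ->
  exists j : X -> X, exists y : X,
    [/\ {homo j : x x' / x < x'}, forall x, C (j x), C y & forall x, y < j x].
Proof.
move=> [[v Cv] Cconv Cnmin _].
have below x : C x -> exists2 y, C y & y < x.
  move=> Cx; apply: contrapT => /forall2NP h; apply: Cnmin; exists x; split=> //.
  by move=> y Cy; rewrite leNgt; apply/negP; case: (h y).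
have [u Cu uv] := below _ Cv; have [y Cy yu] := below _ Cu.
have [k kiso] := X_homog _ _ (open_convex_itv _ _ lt_ab) (open_convex_itv _ _ uv).
have kuv x : a < x < b -> u < k x < v by case: kiso => -[kF _ _] _; apply: kF.
(* [k] maps ]a, b[ onto ]u, v[; it is completed by sending [a] to [u] and [b]
   to [v]. *)
pose j x := if x == a then u else if x == b then v else k x.
have inside x : x != a -> x != b -> a < x < b.
  by move=> xa xb'; rewrite !lt_neqAle ax xb xb' eq_sym xa.
have uj x : u <= j x.
  rewrite /j; case: eqVneq => // xa; case: eqVneq => [_|xb']; first exact: ltW.
  by have /andP[/ltW] := kuv _ (inside _ xa xb').
have jv x : j x <= v.
  rewrite /j; case: eqVneq => [_|xa]; first exact: ltW.
  case: eqVneq => // xb'.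
  by have /andP[_ /ltW] := kuv _ (inside _ xa xb').
exists j, y; split => //; last by move=> x; apply: lt_le_trans (uj x).
- move=> x x' xx'; rewrite /j.
  have x'a : x' != a by apply/eqP => e; move: xx'; rewrite e ltNge ax.
  have xb' : x != b by apply/eqP => e; move: xx'; rewrite e ltNge xb.
  rewrite (negbTE x'a) (negbTE xb').
  case: (eqVneq x a) => [_|xa]; case: (eqVneq x' b) => [_|x'b] //.
  + by have /andP[] := kuv _ (inside _ x'a x'b).
  + by have /andP[] := kuv _ (inside _ xa xb').
  + by apply: (order_iso_lt _ _ _ _ _ kiso) => //; apply: inside.
- move=> x; have := uj x; rewrite le_eqVlt => /orP[/eqP<- //|ujx].
  have := jv x; rewrite le_eqVlt => /orP[/eqP-> //|jxv].
  exact: Cconv ujx jxv.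
Qed.

(** The unused point [y] of [W] has its value [phi y] strictly below those taken
    by [phi] on the image of [j]. *)
Lemma embedding_in_copy phi W Y : iso_copy phi W Y ->
  exists j : X -> X, exists y : X,
    [/\ {homo j : x x' / x < x'}, forall x, W (j x), W y,
        {homo phi \o j : x x' / x < x'} & forall x, phi y < phi (j x)].
Proof.
move=> [YW [C [Copen /order_isomorphic_sym[g giso]]] phiiso].
have [j [y [jm Cj Cy yj]]] := embedding_in_open_convex _ Copen.
have gY x : C x -> Y (g x) by case: giso => -[gF _ _] _; apply: gF.
have gm x x' : C x -> C x' -> x < x' -> g x < g x'.
  exact: order_iso_lt giso.
have phim x x' : Y x -> Y x' -> x < x' -> phi x < phi x'.
  exact: order_iso_lt phiiso.
exists (g \o j), (g y); split.
- by move=> x x' xx' /=; apply: gm => //; apply: jm.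
- by move=> x; apply/YW/gY.
- exact/YW/gY.
- move=> x x' xx' /=; apply: phim; [exact: gY|exact: gY|].
  by apply: gm => //; apply: jm.
- by move=> x; apply: phim; [exact: gY|exact: gY|apply: gm].
Qed.

(** The map sends [a, c] into ]c, b[ and ]c, b] into ]a, c[. *)
Lemma injective_rotation : exists psi : X -> X, exists x y : X,
  [/\ OP X psi, injective psi, a < x < y, y < b & psi y < psi x].
Proof.
have [c [ac cb]] := X_dense _ _ lt_ab.
have [j1 [_ [m1 C1 _ _]]] := embedding_in_open_convex _ (open_convex_itv _ _ cb).
have [j2 [_ [m2 C2 _ _]]] := embedding_in_open_convex _ (open_convex_itv _ _ ac).
have j21 x y : j2 y < j1 x.
  have /andP[_ h2] := C2 y; have /andP[h1 _] := C1 x; exact: lt_trans h2 h1.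
pose psi x := if x <= c then j1 x else j2 x.
have [x [lt_ax xc]] := X_dense _ _ ac; have [y [cy yb]] := X_dense _ _ cb.
exists psi, x, y; split.
- exists [set z | z <= c]; split; first by exists c => /=.
  + by move=> p q /= pc qc; rewrite /psi pc qc; apply: (ltW_homo m1).
  + move=> p q /= /negP pc /negP qc; rewrite /psi (negbTE pc) (negbTE qc).
    exact: (ltW_homo m2).
  + move=> p q /= pc /negP qc; rewrite /psi pc (negbTE qc) (ltW (j21 _ _)).
    by split=> //; apply: le_lt_trans pc _; rewrite ltNge.
- move=> p q; rewrite /psi; case: ifP => _; case: ifP => _.
  + exact: (inc_inj (le_mono m1)).
  + by move=> e; have := j21 p q; rewrite e ltxx.
  + by move=> e; have := j21 q p; rewrite e ltxx.
  + exact: (inc_inj (le_mono m2)).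
- by rewrite lt_ax (lt_trans xc cy).
- exact: yb.
- by rewrite /psi (ltW xc) leNgt cy /= j21.
Qed.

(** * Factorization through an orientation-preserving map *)

Context (X_complete : cut_complete X).

(** The cut is that of the down-closure [A] of [S]: the supremum is the maximum
    of [A] or, failing that, the minimum of its complement. *)
Lemma exists_supremum (S : set X) :
  exists s, ubound S s /\ forall u, ubound S u -> s <= u.
Proof.
have [S0|/forallNP S0] := pselect (S !=set0); last first.
  by exists a; split=> [x /S0 //|u _].
pose A := [set x | exists2 s, S s & x <= s].
have SA s : S s -> A s by exists s.
have [[m [[s Ss ms] mub]]|nmax] := pselect (exists m, is_max A m).
  exists m; split=> [x /SA/mub //|u uub].
  exact: le_trans ms (uub _ Ss).
have [||||//|[m [nAm mlb]]] := X_complete A (~` A).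
- exact: setUv.
- move=> x y [s Ss xs] nAy; rewrite ltNge; apply/negP => yx; apply: nAy.
  by exists s => //; apply: le_trans xs.
- by case: S0 => s /SA; exists s.
- exists b => Ab; apply: nmax; exists b; split=> // x _; exact: xb.
exists m; split=> [x Sx|u uub].
  by rewrite leNgt; apply/negP => mx; apply: nAm; exists x => //; apply: ltW.
apply: mlb => Au; apply: nmax; exists u; split=> // x [s Ss xs].
exact: le_trans xs (uub _ Ss).
Qed.

(** The factor is the least monotone one, namely
    [beta t = sup {psi x | h x <= t}]. *)
Lemma monotone_factor h psi : (forall x y, h x <= h y -> psi x <= psi y) ->
  exists2 beta, Ord X beta & forall x, beta (h x) = psi x.
Proof.
move=> hpsi.
have [beta betaP] := choice (fun t => exists_supremum [set psi x | x in [set x | h x <= t]]).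
exists beta => [s t _ _ st|x].
  have [_ least] := betaP s; have [ub _] := betaP t.
  by apply: least => _ [x /= xs <-]; apply: ub; exists x => //=; apply: le_trans st.
have [ub least] := betaP (h x); apply/eqP; rewrite eq_le; apply/andP; split.
  by apply: least => _ [y /= yx <-]; apply: hpsi.
by apply: ub; exists x => /=.
Qed.

Lemma OP_factor phi A : is_ideal phi A ->
  (exists Y, iso_copy phi A Y) -> (exists Y, iso_copy phi (~` A) Y) ->
  forall psi, OP X psi -> exists alpha beta,
    [/\ Ord X alpha, Ord X beta & psi = (alpha \; phi \; beta)%FUN].
Proof.
move=> [_ _ _ phiA] [Y1 cY1] [Y2 cY2] psi [Z [_ psi1 psi2 psi3]].
have [j1 [y [m1 A1 Ay pm1 yj1]]] := embedding_in_copy _ _ _ cY1.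
have [j2 [_ [m2 A2 _ pm2 _]]] := embedding_in_copy _ _ _ cY2.
pose alpha x := if `[< Z x >] then j1 x else j2 x.
have alpha1 x : Z x -> alpha x = j1 x by move=> Zx; rewrite /alpha asboolT.
have alpha2 x : ~ Z x -> alpha x = j2 x by move=> Zx; rewrite /alpha asboolF.
(* The unused point [y] of [Y1] separates the two images strictly. *)
have sep x x' : phi (j2 x') < phi (j1 x).
  by have [_ h] := phiA _ _ Ay (A2 x'); apply: le_lt_trans h (yj1 x).
have [beta betaO betaE] : exists2 beta, Ord X beta &
    forall x, beta ((alpha \; phi)%FUN x) = psi x.
  apply: monotone_factor => x x' /=.
  have [Zx|nZx] := pselect (Z x); have [Zx'|nZx'] := pselect (Z x').
  - rewrite !alpha1 // => le; apply: psi1 => //.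
    by rewrite leNgt; apply/negP => /pm1 /=; rewrite ltNge le.
  - by rewrite alpha1 // alpha2 // leNgt sep.
  - by move=> _; have [] := psi3 _ _ Zx' nZx.
  - rewrite !alpha2 // => le; apply: psi2 => //.
    by rewrite leNgt; apply/negP => /pm2 /=; rewrite ltNge le.
exists alpha, beta; split=> //; last by apply/funext => x; rewrite -betaE.
move=> x x' _ _ xx'.
have [Zx|nZx] := pselect (Z x); have [Zx'|nZx'] := pselect (Z x').
- by rewrite !alpha1 //; apply: (ltW_homo m1).
- by rewrite alpha1 // alpha2 // ltW //; have [] := phiA _ _ (A1 x) (A2 x').
- by have [] := psi3 _ _ Zx' nZx; rewrite ltNge xx'.
- by rewrite !alpha2 //; apply: (ltW_homo m2).
Qed.

End Maps.

Theorem proposition6 (d : Order.disp_t) (X : orderType d)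
    (X_infinite : infinite_set [set: X])
    (X_dense : dense_order X)
    (X_complete : cut_complete X)
    (X_homog : open_convex_isomorphic X)
    (a b : X) (a_min : is_min [set: X] a) (b_max : is_max [set: X] b)
    (phi : X -> X) (phi_OP : (OP X `\` Ord X) phi)
    (X1 : set X) (X1_ideal : is_ideal phi X1)
    (X2 : set X) (X2E : X2 = [set: X] `\` X1) :
  generated_semigroup (Ord X `|` [set phi]) = OP X
  <->
  (forall Xi : set X, Xi = X1 \/ Xi = X2 ->
     exists Y : set X,
       [/\ Y `<=` Xi,
           exists C : set X, open_convex C /\ order_isomorphic Y C &
           order_iso_on Y (phi @` Y) phi]).
Proof.
have [phiOP _] := phi_OP; rewrite setTD in X2E; subst X2.
have lt_ab : a < b.
  rewrite lt_neqAle (a_min.2 b) // andbT; apply/eqP => ab; apply: X_infinite.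
  suff -> : [set: X] = [set a] by exact: finite_set1.
  apply/seteqP; split=> // x _ /=; apply/eqP.
  by rewrite eq_le (a_min.2 x) // andbT ab (b_max.2 x).
have [_ mono1 mono2 _] := X1_ideal.
split=> [genE Xi XiE|copies].
- apply: contrapT => noY.
  have [psi [x [y [psiOP psiI /andP[lt_ax xy] yb psiyx]]]] :=
    injective_rotation X_dense _ _ a_min b_max X_homog lt_ab.
  rewrite -genE in psiOP.
  have lt_ay := lt_trans lt_ax xy; have lt_xb := lt_trans xy yb.
  have absurd (U : set X) : U x -> U y -> ~ order_preserving_on U psi.
    by move=> Ux Uy /(_ _ _ Ux Uy (ltW xy)); rewrite leNgt psiyx.
  case: XiE => XiE; subst Xi.
  + apply: (absurd [set z | a < z]) => //.
    apply: (generated_injective_monotone phi _ X1) psiOP psiI => // f fm.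
    exact: ideal_preimage_open X1_ideal fm.
  + apply: (absurd [set z | z < b]) => //.
    apply: (generated_injective_monotone phi _ (~` X1)) psiOP psiI => //.
      by rewrite setCK.
    move=> f fm; exact: coideal_preimage_open X1_ideal fm.
- apply/seteqP; split.
    apply: smallest_sub; first exact: OP_comp_closed.
    by move=> f [/(Ord_sub_OP a)//|->].
  move=> psi psiOP M [Mcomp Mgen].
  have [alpha [beta [alphaO betaO ->]]] := OP_factor X_dense _ _ a_min b_max
    X_homog lt_ab X_complete _ _ X1_ideal (copies _ (or_introl erefl))
    (copies _ (or_intror erefl)) _ psiOP.
  apply: (Mcomp); last apply: (Mcomp).
  - by apply: Mgen; left.
  - by apply: Mgen; right.
  - by apply: Mgen; left.
Qed.
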